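(* The weighted Max-Bond problem can be solved in time $O(n)$ on the wheel graph $W_n$: given real weights on the edges of $W_n$, a bond of $W_n$ of maximum total edge weight can be computed in $O(n)$ time.
   Context: For $n\ge3$, the wheel $W_n$ has vertices $0,\dots,n-1$ and a hub $c$, rim edges $\{i,i+1\}$ (indices mod $n$) and spokes $\{i,c\}$. A bond of a graph $G=(V,E)$ is a cut $(S,V\setminus S)$ such that both $G[S]$ and $G[V\setminus S]$ are connected; its weight is the total weight of the edges of $\delta(S)$ (edges with exactly one endpoint in $S$). The weighted Max-Bond problem asks for a bond of maximum weight. *)

(* Defs.v *)
From mathcomp Require Import all_boot all_order all_algebra.
From mathcomp Require Export reals.

Set Implicit Arguments.
Unset Strict Implicit.
Unset Printing Implicit Defensive.

Import Order.TTheory GRing.Theory Num.Theory.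
Local Open Scope ring_scope.

(** * Bonds of a graph, given by its (symmetric, irreflexive) adjacency e *)

Definition edges (T : finType) (e : rel T) : {set {set T}} :=
  [set [set p.1; p.2] | p : T * T & e p.1 p.2].

(* Connectedness of the subgraph induced by A; as usual, the graph without
   vertices is not connected. *)
Definition connected_in (T : finType) (e : rel T) (A : {set T}) : bool :=
  (A != set0) && [forall x in A, forall y in A,
                    connect [rel u v in A | e u v] x y].

Definition is_bond (T : finType) (e : rel T) (S : {set T}) : bool :=
  connected_in e S && connected_in e (~: S).

Definition cut_edges (T : finType) (e : rel T) (S : {set T}) : {set {set T}} :=
  [set d in edges e | #|d :&: S| == 1%N].

Definition cut_weight (R : realType) (T : finType) (e : rel T)
    (w : {set T} -> R) (S : {set T}) : R :=
  \sum_(d in cut_edges e S) w d.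

Definition is_max_bond (R : realType) (T : finType) (e : rel T)
    (w : {set T} -> R) (S : {set T}) : Prop :=
  is_bond e S /\
  forall S' : {set T}, is_bond e S' -> cut_weight e w S' <= cut_weight e w S.

(* [Some i] is the rim vertex i, [None] is the hub c. *)
Definition wheel (n : nat) : rel (option 'I_n) := fun u v =>
  match u, v with
  | Some i, Some j => (j == ordS i) || (i == ordS j)
  | None, None => false
  | _, _ => true
  end.
Arguments wheel n : clear implicits.

(** * Real RAM *)

(* A program refers to finitely many registers and arrays, by literal names;
   arrays are addressed through integer registers.  Arithmetic is
   deliberately weak: on integers only successor and predecessor, so that an
   integer reached in t steps from the input n is at most max(n, k) + t, with k
   the largest literal of the program; on reals only addition, subtraction and
   comparison.  No real literals are available, and no conversion between
   integers and reals. *)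
Inductive instr : Type :=
  | IConst of nat & nat        (* I[x] := k *)
  | IMove of nat & nat         (* I[x] := I[y] *)
  | ISucc of nat               (* I[x] := I[x] + 1 *)
  | IPred of nat               (* I[x] := I[x] - 1, truncated at 0 *)
  | ILoad of nat & nat & nat   (* I[x] := IA[a][I[y]] *)
  | IStore of nat & nat & nat  (* IA[a][I[x]] := I[y] *)
  | RMove of nat & nat         (* X[x] := X[y] *)
  | RAdd of nat & nat & nat    (* X[x] := X[y] + X[z] *)
  | RSub of nat & nat & nat    (* X[x] := X[y] - X[z] *)
  | RLoad of nat & nat & nat   (* X[x] := XA[a][I[y]] *)
  | RStore of nat & nat & nat. (* XA[a][I[x]] := X[y] *)

Inductive test : Type :=
  | ILt of nat & nat           (* I[x] < I[y] *)
  | RLt of nat & nat.          (* X[x] < X[y] *)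

Inductive program : Type :=
  | Skip
  | Do of instr
  | Seq of program & program
  | If of test & program & program
  | While of test & program.

Record state (R : realType) : Type := State {
  ireg : nat -> nat;         (* I *)
  rreg : nat -> R;           (* X *)
  iarr : nat -> nat -> nat;  (* IA *)
  rarr : nat -> nat -> R     (* XA *)
}.

Definition upd (A : Type) (f : nat -> A) (x : nat) (v : A) : nat -> A :=
  fun y => if y == x then v else f y.

Definition upd2 (A : Type) (f : nat -> nat -> A) (a x : nat) (v : A) :
    nat -> nat -> A :=
  upd f a (upd (f a) x v).

Definition set_ireg (R : realType) (s : state R) (x v : nat) : state R :=
  State (upd (ireg s) x v) (rreg s) (iarr s) (rarr s).
Definition set_rreg (R : realType) (s : state R) (x : nat) (v : R) : state R :=
  State (ireg s) (upd (rreg s) x v) (iarr s) (rarr s).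
Definition set_iarr (R : realType) (s : state R) (a x v : nat) : state R :=
  State (ireg s) (rreg s) (upd2 (iarr s) a x v) (rarr s).
Definition set_rarr (R : realType) (s : state R) (a x : nat) (v : R) :
    state R :=
  State (ireg s) (rreg s) (iarr s) (upd2 (rarr s) a x v).

Definition exec (R : realType) (c : instr) (s : state R) : state R :=
  match c with
  | IConst x k => set_ireg s x k
  | IMove x y => set_ireg s x (ireg s y)
  | ISucc x => set_ireg s x (ireg s x).+1
  | IPred x => set_ireg s x (ireg s x).-1
  | ILoad x a y => set_ireg s x (iarr s a (ireg s y))
  | IStore a x y => set_iarr s a (ireg s x) (ireg s y)
  | RMove x y => set_rreg s x (rreg s y)
  | RAdd x y z => set_rreg s x (rreg s y + rreg s z)
  | RSub x y z => set_rreg s x (rreg s y - rreg s z)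
  | RLoad x a y => set_rreg s x (rarr s a (ireg s y))
  | RStore a x y => set_rarr s a (ireg s x) (rreg s y)
  end.

Definition holds (R : realType) (b : test) (s : state R) : bool :=
  match b with
  | ILt x y => (ireg s x < ireg s y)%N
  | RLt x y => rreg s x < rreg s y
  end.

(* [run p s t s']: started in s, the program p halts in s' after t steps.
   Every executed instruction, and every evaluation of a test, is a step. *)
Inductive run (R : realType) : program -> state R -> nat -> state R -> Prop :=
  | RunSkip s : run Skip s 1 s
  | RunDo c s : run (Do c) s 1 (exec c s)
  | RunSeq p q s t s1 u s2 :
      run p s t s1 -> run q s1 u s2 -> run (Seq p q) s (t + u) s2
  | RunIfT b p q s t s' :
      holds b s -> run p s t s' -> run (If b p q) s t.+1 s'
  | RunIfF b p q s t s' :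
      ~~ holds b s -> run q s t s' -> run (If b p q) s t.+1 s'
  | RunWhileT b p s t s1 u s2 :
      holds b s -> run p s t s1 -> run (While b p) s1 u s2 ->
      run (While b p) s (t + u).+1 s2
  | RunWhileF b p s :
      ~~ holds b s -> run (While b p) s 1 s.

(** * Input and output for the wheel *)

(* I[0] = n, XA[0][i] is the weight of the rim edge {i, i+1} and XA[1][i] that
   of the spoke {i, c}, for i < n; everything else is 0. *)
Definition wheel_input (R : realType) (n : nat)
    (w : {set option 'I_n} -> R) : state R :=
  State
    (fun x => if x == 0%N then n else 0%N)
    (fun _ => 0)
    (fun _ _ => 0%N)
    (fun a k =>
       match a, (insub k : option 'I_n) with
       | 0%N, Some i => w [set Some i; Some (ordS i)]
       | 1%N, Some i => w [set Some i; None]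
       | _, _ => 0
       end).

Definition vertex_index (n : nat) (v : option 'I_n) : nat :=
  if v is Some i then val i else n.

(* The characteristic function of S is stored in IA[0][0..n], the hub being at
   position n. *)
Definition wheel_output (R : realType) (n : nat) (s : state R)
    (S : {set option 'I_n}) : Prop :=
  forall v : option 'I_n, iarr s 0 (vertex_index v) = (v \in S) :> nat.

(* Main.v *)
(* Replacing S by its complement, one may assume that the rim vertex 0 is not
   in S.  Then S is a bond iff it is an interval [lo, hi) of {1, ..., n-1},
   nonempty and without the hub, or possibly empty and together with the hub:
   a gap in the interval would disconnect the side of the cut that avoids the
   hub, a side containing the hub being always connected.  If the interval is
   nonempty, the cut consists of the two rim edges at its ends and of the
   spokes to its vertices (if the hub is outside S) or to the others (if the
   hub is in S); for each of the two types the best interval is found by a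
   left to right scan, as in Kadane's maximum subarray algorithm. *)
Require Import Defs.
From mathcomp Require Import all_boot all_order all_algebra.
From mathcomp Require Import zify ring lra.

Set Implicit Arguments.
Unset Strict Implicit.
Unset Printing Implicit Defensive.

Import Order.TTheory GRing.Theory Num.Theory.
Local Open Scope ring_scope.

(** * Bonds of the wheel *)

Lemma wheel_sym n : symmetric (wheel n).
Proof. by move=> [i|] [j|] //=; rewrite orbC. Qed.

Lemma induced_sym (T : finType) (e : rel T) (A : {set T}) :
  symmetric e -> connect_sym [rel u v in A | e u v].
Proof.
move=> esym; apply: sym_connect_sym => u v /=.
by rewrite esym [(u \in A) && _]andbC.
Qed.

Lemma connected_in_root (T : finType) (e : rel T) (A : {set T}) (x : T) :
  symmetric e -> x \in A ->
  (forall y, y \in A -> connect [rel u v in A | e u v] x y) ->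
  connected_in e A.
Proof.
move=> esym xA cx; apply/andP; split; first by apply/set0Pn; exists x.
apply/forall_inP => y yA; apply/forall_inP => z zA.
by apply: connect_trans (cx z zA); rewrite induced_sym //; exact: cx.
Qed.

(** [P] propagates along a path inside [A]. The use is contrapositive: a predicate that is closed
    under adjacency within [A] and separates two vertices of [A] contradicts connectedness. *)
Lemma connected_in_closed (T : finType) (e : rel T) (A : {set T})
    (P : pred T) x y :
  connected_in e A -> x \in A -> y \in A -> P x ->
  (forall u v, u \in A -> v \in A -> e u v -> P u -> P v) -> P y.
Proof.
move=> /andP[_ /forall_inP cA] xA yA Px Pcl.
have /connectP[p + ->] := forall_inP (cA x xA) y yA.
elim: p x xA Px => //= z p IHp x xA Px /andP[/andP[/andP[_ zA] exz] pz].
by apply: (IHp z) => //; exact: Pcl exz Px.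
Qed.

Lemma ordS_val n (i : 'I_n) :
  (ordS i : nat) = if (i.+1 < n)%N then i.+1 else 0%N.
Proof.
rewrite /=; case: ltnP => h; first exact: modn_small.
have -> : (i.+1 = n)%N by apply/eqP; rewrite eqn_leq ltn_ord.
exact: modnn.
Qed.

(** Removes the modular successor: the wrap-around edge becomes two separate cases, and adjacency is
    left to linear arithmetic. *)
Lemma wheel_rimE n (i j : 'I_n) : wheel n (Some i) (Some j) =
  [|| (j == i.+1 :> nat), (i == j.+1 :> nat),
      (i == 0%N :> nat) && (j.+1 == n) | (j == 0%N :> nat) && (i.+1 == n)].
Proof.
rewrite /= -!val_eqE; have := ordS_val i; have := ordS_val j.
rewrite /= => -> ->; have := ltn_ord i; have := ltn_ord j.
by case: ifP; case: ifP; lia.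
Qed.

Lemma hub_connected n (A : {set option 'I_n}) :
  None \in A -> connected_in (wheel n) A.
Proof.
move=> hA; apply: (connected_in_root (x := None)) => //; first exact: wheel_sym.
by move=> [i|] yA; [apply: connect1; rewrite /= hA yA|exact: connect0].
Qed.

Lemma rim_connect n (A : {set option 'I_n}) (i j : 'I_n) :
  (i <= j)%N -> (forall k : 'I_n, (i <= k <= j)%N -> Some k \in A) ->
  connect [rel u v in A | wheel n u v] (Some i) (Some j).
Proof.
case: j => j; elim: j => [|j IHj] jn /= ij kA.
  by rewrite (_ : i = Ordinal jn) ?connect0 //; apply: val_inj => /=; lia.
case: (ltngtP i j.+1) ij => // [ij|ij] _; last first.
  by rewrite (_ : i = Ordinal jn) ?connect0 //; apply: val_inj => /=; lia.
have jn' : (j < n)%N by lia.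
apply: (@connect_trans _ _ (Some (Ordinal jn'))).
  by apply: IHj => // k /= hk; apply: kA; lia.
apply: connect1; apply/andP; split; last by rewrite wheel_rimE eqxx.
by rewrite !kA //=; lia.
Qed.

Definition arc_set (n : nat) (b : bool) (lo hi : nat) : {set option 'I_n} :=
  [set v : option 'I_n | if v is Some i then lo <= i < hi else b]%N.

(* The empty interval is represented by [lo = hi = 1] only. *)
Definition candidate (n : nat) (b : bool) (lo hi : nat) : bool :=
  (0 < lo)%N && (hi <= n)%N && ((lo < hi)%N || [&& b, lo == 1%N & hi == 1%N]).

(** The side with the hub is connected through it. The other side is a path: the interval itself, or
    the rim vertices outside it, where those below [lo] are reached from 0 upwards and those from
    [hi] on through the edge from 0 to [n-1]. *)
Lemma arc_set_bond n b lo hi : (2 < n)%N -> candidate n b lo hi ->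
  is_bond (wheel n) (arc_set n b lo hi).
Proof.
move=> n2 /andP[/andP[lo0 hin]]; case: b => [_|]; last first.
  rewrite orbF => lohi; apply/andP; split; last first.
    by apply: hub_connected; rewrite !inE.
  have lon : (lo < n)%N by lia.
  apply: (connected_in_root (x := Some (Ordinal lon))).
  - exact: wheel_sym.
  - by rewrite inE /= leqnn.
  - case=> [j|]; rewrite inE // => /andP[loj jhi].
    by apply: rim_connect => // k /= hk; rewrite inE; lia.
apply/andP; split; first by apply: hub_connected; rewrite inE.
have n0 : (0 < n)%N by lia.
have zA : Some (Ordinal n0) \in ~: arc_set n true lo hi by rewrite !inE /=; lia.
apply: (connected_in_root (x := Some (Ordinal n0))) => //.
  exact: wheel_sym.
case=> [j|]; rewrite !inE // => jA.
case: (ltnP j lo) => jlo.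
  by apply: rim_connect => // k /= hk; rewrite !inE; lia.
have jn := ltn_ord j; have n1 : (n.-1 < n)%N by lia.
have lA : Some (Ordinal n1) \in ~: arc_set n true lo hi by rewrite !inE /=; lia.
apply: (@connect_trans _ _ (Some (Ordinal n1))).
  apply: connect1; apply/andP; split; first by rewrite zA lA.
  by rewrite wheel_rimE /=; lia.
rewrite induced_sym; last exact: wheel_sym.
by apply: rim_connect => [|k] /=; [|move=> hk; rewrite !inE]; lia.
Qed.

Lemma cut_edgesC (T : finType) (e : rel T) (S : {set T}) :
  irreflexive e -> cut_edges e (~: S) = cut_edges e S.
Proof.
move=> eirr; apply/setP => d; rewrite !inE.
case: imsetP => //= -[[x y]]; rewrite inE /= => exy ->.
have nxy : x != y by apply: contraTneq exy => ->; rewrite eirr.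
have := cardsID S [set x; y]; rewrite cards2 nxy setDE; lia.
Qed.

Lemma bondC (T : finType) (e : rel T) (S : {set T}) :
  is_bond e (~: S) = is_bond e S.
Proof. by rewrite /is_bond setCK andbC. Qed.

(** The interval spans the least to the greatest rim vertex of [S]. Suppose that [k] between them is
    missing. If the hub is in [S], the complement cannot get from [k] to 0 past [lo] and [hi];
    otherwise [S] cannot get from [lo] to [hi] past [k] and 0. *)
Lemma bond_arc_set n (S : {set option 'I_n}) (z : 'I_n) :
  is_bond (wheel n) S -> val z = 0%N -> Some z \notin S ->
  exists b lo hi, candidate n b lo hi /\ S = arc_set n b lo hi.
Proof.
move=> /andP[cS cSC] z0 zS; exists (None \in S).
case: (pickP (fun i : 'I_n => Some i \in S)) => [i0 i0S|noS]; last first.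
  have hS : None \in S.
    by have /andP[/set0Pn[[i|//]] + _] := cS; rewrite noS.
  exists 1%N, 1%N; split.
    by rewrite /candidate hS; have := ltn_ord z; lia.
  by apply/setP => -[i|]; rewrite inE ?noS //; lia.
case: (@arg_minnP _ i0 (fun i => Some i \in S) val i0S) => /= lo loS lo_min.
case: (@arg_maxnP _ i0 (fun i => Some i \in S) val i0S) => /= hi hiS hi_max.
have pos (i : 'I_n) : Some i \in S -> (0 < i)%N.
  rewrite lt0n; apply: contraL => /eqP i_0; rewrite (_ : i = z) //.
  by apply: val_inj; rewrite z0.
have lohi : (lo <= hi)%N by exact: lo_min.
exists lo, hi.+1; split.
  by rewrite /candidate pos // ltn_ord ltnS lohi.
apply/setP => -[k|]; rewrite inE //.
apply/idP/idP => [kS|/andP[lok khi]].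
  by rewrite lo_min // ltnS; apply: hi_max.
apply/negPn/negP => kS.
have klo : (k != lo :> nat) by apply: contraNneq kS => /val_inj ->.
have khi' : (k != hi :> nat) by apply: contraNneq kS => /val_inj ->.
case: (boolP (None \in S)) => hS.
  pose P (v : option 'I_n) := if v is Some i then (lo < i < hi)%N else true.
  have : P (Some z).
    apply: (connected_in_closed (P := P) (x := Some k) cSC);
      rewrite /P ?inE //; first by lia.
    move=> [u|] [v|]; rewrite ?inE ?hS // wheel_rimE => uS vS euv luh.
    have vlo : (v != lo :> nat) by apply: contraNneq vS => /val_inj ->.
    have vhi : (v != hi :> nat) by apply: contraNneq vS => /val_inj ->.
    have := ltn_ord hi; lia.
  by rewrite /P z0.
pose P (v : option 'I_n) := if v is Some i then (i < k)%N else true.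
have : P (Some hi).
  apply: (connected_in_closed (P := P) (x := Some lo) cS);
    rewrite /P ?inE //; first by lia.
  move=> [u|] [v|]; rewrite ?(negPf hS) // wheel_rimE => uS vS euv uk.
  have vk : (v != k :> nat) by apply: contraNneq kS => /val_inj <-.
  have := pos _ uS; have := pos _ vS; have := ltn_ord k; lia.
by rewrite /P; lia.
Qed.

(** * Weights of the cuts of the wheel *)

Lemma wheel_cut_weight (R : realType) n (w : {set option 'I_n} -> R)
    (S : {set option 'I_n}) : (2 < n)%N ->
  cut_weight (wheel n) w S =
    \sum_(i < n | (Some i \in S) != (Some (ordS i) \in S))
       w [set Some i; Some (ordS i)] +
    \sum_(i < n | (Some i \in S) != (None \in S)) w [set Some i; None].
Proof.
move=> n2.
pose rim (i : 'I_n) := [set Some i; Some (ordS i)].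
pose spoke (i : 'I_n) : {set option 'I_n} := [set Some i; None].
have ordS_neq (i : 'I_n) : ordS i != i.
  rewrite -val_eqE [val (ordS i)]ordS_val; have := ltn_ord i.
  by case: ifP => /=; lia.
(* Here [n] must be at least 3: on two rim vertices both indices would give the same edge. *)
have rim_inj : injective rim.
  move=> i j /setP eij; have := eij (Some i); have := eij (Some (ordS i)).
  rewrite !inE !eqxx !orbT /= !(inj_eq Some_inj).
  rewrite -!val_eqE [val (ordS i)]ordS_val [val (ordS j)]ordS_val => h1 h2.
  apply: val_inj => /=; move: (esym h1) (esym h2).
  by have := ltn_ord i; have := ltn_ord j; do 2 case: ifP => /=; lia.
have spoke_inj : injective spoke.
  by move=> i j /setP/(_ (Some i)); rewrite !inE eqxx !orbF => /esym/eqP[].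
have cardI (x y : option 'I_n) : x != y ->
    (#|[set x; y] :&: S| == 1)%N = ((x \in S) != (y \in S)).
  move=> nxy; rewrite setIUl cardsU.
  rewrite (_ : _ :&: _ :&: _ = set0) ?cards0 ?subn0; last first.
    apply/setP => v; rewrite !inE; case: eqP => [->|//].
    by rewrite (negPf nxy) andbF.
  have cI z : #|[set z] :&: S| = (z \in S).
    case: (boolP (z \in S)) => zS.
      by rewrite (setIidPl _) ?sub1set // cards1.
    apply/eqP; rewrite cards_eq0; apply/eqP/setP => v; rewrite !inE.
    by case: eqP => [->|//]; rewrite (negPf zS).
  by rewrite !cI; case: (x \in S); case: (y \in S).
have cutE : cut_edges (wheel n) S =
    rim @: [set i | (Some i \in S) != (Some (ordS i) \in S)] :|:
    spoke @: [set i | (Some i \in S) != (None \in S)].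
  apply/setP => d; rewrite inE [in RHS]inE; apply/andP/orP.
    move=> [/imsetP[[x y]]]; rewrite inE /= => exy ->.
    have nxy : x != y.
      apply: contraTneq exy => ->; case: y => //= i.
      by rewrite eq_sym orbb ordS_neq.
    rewrite cardI //; move: exy; case: x nxy => [i|]; case: y => [j|] //= _.
    - case/orP => /eqP -> sS; left.
        by apply/imsetP; exists i; rewrite ?inE.
      by apply/imsetP; exists j; rewrite ?inE /rim 1?eq_sym // setUC.
    - by move=> _ sS; right; apply/imsetP; exists i; rewrite ?inE.
    - move=> _ sS; right; apply/imsetP.
      by exists j; rewrite ?inE /spoke 1?eq_sym // setUC.
  case=> /imsetP[i]; rewrite inE => iS ->; split.
  - by apply/imsetP; exists (Some i, Some (ordS i)); rewrite ?inE //= eqxx.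
  - by rewrite cardI // (inj_eq Some_inj) eq_sym.
  - by apply/imsetP; exists (Some i, None); rewrite ?inE.
  - by rewrite cardI.
rewrite /cut_weight cutE (eq_bigl _ _ (fun d => in_setU d _ _)).
rewrite bigU /=; last first.
  rewrite -setI_eq0; apply/eqP/setP => d; rewrite !inE; apply/andP => -[].
  by move=> /imsetP[i _ ->] /imsetP[j _ /setP/(_ None)]; rewrite !inE.
rewrite (big_imset _ (in2W rim_inj)) (big_imset _ (in2W spoke_inj)) /=.
by congr (_ + _); apply: eq_bigl => i; rewrite inE.
Qed.

Definition interval_weight (R : realType) (n : nat) (A : nat -> nat -> R)
    (b : bool) (lo hi : nat) : R :=
  let spokes i j := \sum_(i <= k < j) A 1%N k in
  if b then spokes 0%N n - spokes lo hi else spokes lo hi.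

(** Rim edge [i] joins [i] and [i+1], so the edges leaving the interval have indices [lo-1] and
    [hi-1]. The default 0 is for the hub alone, whose cut has no rim edge. *)
Definition candidate_weight (R : realType) (n : nat) (A : nat -> nat -> R)
    (b : bool) (lo hi : nat) : R :=
  interval_weight n A b lo hi +
  (if (lo < hi)%N then A 0%N lo.-1 + A 0%N hi.-1 else 0).

Lemma wheel_arc_weight (R : realType) n (w : {set option 'I_n} -> R) b lo hi :
  (2 < n)%N -> candidate n b lo hi ->
  cut_weight (wheel n) w (arc_set n b lo hi) =
  candidate_weight n (rarr (wheel_input w)) b lo hi.
Proof.
move=> n2 c; rewrite wheel_cut_weight // addrC /candidate_weight.
set A := rarr _.
have A0 (i : 'I_n) : w [set Some i; Some (ordS i)] = A 0%N i.
  by rewrite /A /= valK.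
have A1 (i : 'I_n) : w [set Some i; None] = A 1%N i by rewrite /A /= valK.
have [lo0 [lohi hin]] : (0 < lo /\ lo <= hi /\ hi <= n)%N.
  by move: c; rewrite /candidate; lia.
congr (_ + _).
  transitivity (\sum_(i < n | (lo <= i < hi)%N != b) A 1%N i).
    by apply: eq_big => [i|i _]; rewrite ?inE.
  have inI : \sum_(i < n | (lo <= i < hi)%N) A 1%N i =
      \sum_(lo <= k < hi) A 1%N k.
    rewrite (big_nat_widen _ _ _ _ _ hin) (big_nat_widenl lo 0%N) // big_mkord.
    by apply: eq_bigl => i; rewrite andbC.
  rewrite /interval_weight; case: (b); last first.
    by rewrite -inI; apply: eq_bigl => i; case: (_ && _).
  rewrite big_mkord -inI.
  rewrite [X in _ = X - _](bigID (fun i : 'I_n => lo <= i < hi)%N) /=.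
  rewrite addrAC subrr add0r.
  by apply: eq_bigl => i; case: (_ && _).
(* At [i = n-1] the cyclic successor 0 may be replaced by [n]: both lie outside the interval, as
   [0 < lo] and [hi <= n]. *)
transitivity (\sum_(i < n | (lo <= i < hi)%N != (lo <= i.+1 < hi)%N) A 0%N i).
  apply: eq_big => [i|i _]; rewrite ?inE // ordS_val; congr (_ != _).
  by case: ifP; have := ltn_ord i; lia.
case: ltnP => lt_lohi; last first.
  by rewrite big_pred0 // => i; lia.
have lo1n : (lo.-1 < n)%N by lia.
have hi1n : (hi.-1 < n)%N by lia.
(* Membership changes exactly from [lo-1] to [lo] and from [hi-1] to [hi]. *)
rewrite (bigD1 (Ordinal lo1n)) /=; last by lia.
rewrite (bigD1 (Ordinal hi1n)) /=; last by rewrite -val_eqE /=; lia.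
rewrite big_pred0 ?addr0 // => i; rewrite -!val_eqE /=; lia.
Qed.

(** * Total correctness with running time *)

(** The existence of a run includes termination; [k] is only an upper bound on the steps, so costs
    may be rounded up. *)
Definition wp (R : realType) (p : program) (k : nat) (Q : state R -> Prop)
    (s : state R) : Prop :=
  exists t s', [/\ run p s t s', (t <= k)%N & Q s'].

Lemma wp_weaken (R : realType) p k l (Q Q' : state R -> Prop) s :
  (k <= l)%N -> (forall s', Q s' -> Q' s') -> wp p k Q s -> wp p l Q' s.
Proof.
move=> lekl QQ' [t [s' [rp let_k Qs']]].
by exists t, s'; split; [exact: rp|exact: leq_trans lekl|exact: QQ'].
Qed.

Lemma wp_skip (R : realType) (Q : state R -> Prop) s : Q s -> wp Skip 1 Q s.
Proof. by move=> Qs; exists 1%N, s; split=> //; constructor. Qed.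

Lemma wp_seq (R : realType) p q k l (Q : state R -> Prop) s :
  wp p k (wp q l Q) s -> wp (Seq p q) (k + l) Q s.
Proof.
move=> [t [s1 [rp let_k [u [s2 [rq leu_l Qs2]]]]]].
by exists (t + u)%N, s2; split; [exact: RunSeq rp rq|exact: leq_add|].
Qed.

Lemma wp_if (R : realType) b p q k (Q : state R -> Prop) s :
  (holds b s -> wp p k Q s) -> (~~ holds b s -> wp q k Q s) ->
  wp (If b p q) k.+1 Q s.
Proof.
move=> wpT wpF; case: (boolP (holds b s)) => hb.
  by have [t [s' [rp le_k Qs']]] := wpT hb;
     exists t.+1, s'; split=> //; exact: RunIfT.
by have [t [s' [rq le_k Qs']]] := wpF hb;
   exists t.+1, s'; split=> //; exact: RunIfF.
Qed.

(** Each of the [m] iterations costs one test and at most [c] steps; the last, failing test adds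
    one. The invariant is indexed by the iteration, so the induction shifts it by one. *)
Lemma wp_while (R : realType) b p c m (Inv : nat -> state R -> Prop) s :
  (forall i s', (i < m)%N -> Inv i s' -> holds b s' /\ wp p c (Inv i.+1) s') ->
  (forall s', Inv m s' -> ~~ holds b s') ->
  Inv 0%N s -> wp (While b p) (m * c.+1).+1 (Inv m) s.
Proof.
elim: m Inv s => [|m IHm] Inv s step stop I0.
  by exists 1%N, s; split=> //; exact/RunWhileF/stop.
have [hb [t [s1 [rp let_c I1]]]] := step 0%N s isT I0.
have [|u [s2 [rw leu Im]]] := IHm (fun i => Inv i.+1) s1 _ stop I1.
  by move=> i s' lt_im; exact: step.
exists (t + u).+1, s2; split=> //; first exact: RunWhileT rp rw.
by rewrite mulSn ltnS; lia.
Qed.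

Definition block (cs : seq instr) : program :=
  foldr (fun c p => Seq (Do c) p) Skip cs.

(** The extra step pays for the closing [Skip]. *)
Lemma wp_block (R : realType) cs (Q : state R -> Prop) s :
  Q (foldl (fun s' c => exec c s') s cs) -> wp (block cs) (size cs).+1 Q s.
Proof.
elim: cs s => [|c cs IHcs] s Qs; first exact: wp_skip.
apply: (@wp_seq _ _ _ 1%N); exists 1%N, (exec c s); split=> //.
  exact: RunDo.
exact: IHcs.
Qed.

(** * The algorithm *)

(* Integer registers: 0 holds n, 1 the scan position j, 2 the left end of the
   best interval open at j, 3, 4 and 5 the ends of the best interval found and
   its hub flag, 7 constantly 0.  Real registers: 0 holds the total weight of
   the spokes, 1 constantly 0, 2 the best cut weight found, 3 the gain of the
   interval open at j, and 4, 5 and 6 are temporaries. *)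
Definition sum_spokes : program :=
  While (ILt 1 0) (block [:: RLoad 3 1 1; RAdd 0 0 3; ISucc 1]).

(** With the hub in S, a rim vertex joining S takes its spoke out of the cut. *)
Definition add_spoke (b : bool) : instr :=
  if b then RSub 3 3 4 else RAdd 3 3 4.

(* The flag [b] tells whether the hub is in S.  As a register name, [~~ b] is
   the real register with the gain of an empty interval. *)
Definition scan_body (b : bool) : program :=
  Seq (block [:: RLoad 4 1 1; add_spoke b; RLoad 5 0 1; RAdd 6 3 5; ISucc 1])
 (Seq (If (RLt 2 6)
          (block [:: RMove 2 6; IMove 3 2; IMove 4 1; IConst 5 b]) Skip)
 (Seq (block [:: RAdd 5 5 (~~ b)])
      (If (RLt 3 5) (block [:: RMove 3 5; IMove 2 1]) Skip))).

(** Starts with the empty interval open at 1. Register 7 supplies the index 0 of the rim edge at its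
    left end. *)
Definition scan (b : bool) : program :=
  Seq (block [:: IConst 1 1; IConst 2 1; RLoad 3 0 7; RAdd 3 3 (~~ b)])
      (While (ILt 1 0) (scan_body b)).

(** The output array is initially zero, so only the hub flag and the ones of the interval are
    stored. *)
Definition write_output : program :=
  Seq (block [:: IStore 0 0 5; IConst 1 1])
      (While (ILt 3 4) (block [:: IStore 0 3 1; ISucc 3])).

(** The first best bond is the hub alone, encoded by [lo = hi = 1]; its cut consists of all
    spokes. *)
Definition wheel_max_bond : program :=
  Seq sum_spokes
 (Seq (block [:: RMove 2 0; IConst 3 1; IConst 4 1; IConst 5 1])
 (Seq (scan false) (Seq (scan true) write_output))).

(** * Invariants and correctness of the phases *)

Definition input_inv (R : realType) (n : nat) (A : nat -> nat -> R)
    (s : state R) : Prop :=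
  [/\ ireg s 0 = n, ireg s 7 = 0%N, rarr s = A & forall a k, iarr s a k = 0%N]
  /\ (rreg s 0 = \sum_(0 <= k < n) A 1%N k /\ rreg s 1 = 0).

(** For each hub flag, [m] tells up to which right end the candidates have been taken into
    account. *)
Definition best_inv (R : realType) (n : nat) (A : nat -> nat -> R)
    (m : bool -> nat) (s : state R) : Prop :=
  exists b : bool,
  [/\ ireg s 5 = b, candidate n b (ireg s 3) (ireg s 4),
      rreg s 2 = candidate_weight n A b (ireg s 3) (ireg s 4) &
      forall b' lo hi, candidate n b' lo hi -> (hi <= m b')%N ->
        candidate_weight n A b' lo hi <= rreg s 2].

(* The gain of an interval open at [j] lacks only the rim edge at its right
   end. *)
Definition scan_inv (R : realType) (n : nat) (A : nat -> nat -> R)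
    (b : bool) (j : nat) (s : state R) : Prop :=
  let gain i := A 0%N i.-1 + interval_weight n A b i j in
  [/\ ireg s 1 = j, (0 < ireg s 2 <= j)%N, rreg s 3 = gain (ireg s 2) &
      forall i, (0 < i <= j)%N -> gain i <= rreg s 3].

Lemma interval_weight_id (R : realType) n (A : nat -> nat -> R) b i :
  interval_weight n A b i i = if b then \sum_(0 <= k < n) A 1%N k else 0.
Proof. by rewrite /interval_weight (big_geq (leqnn i)) subr0. Qed.

Lemma interval_weightS (R : realType) n (A : nat -> nat -> R) b i j :
  (i <= j)%N -> interval_weight n A b i j.+1 =
    if b then interval_weight n A b i j - A 1%N j
    else interval_weight n A b i j + A 1%N j.
Proof.
by move=> le_ij; rewrite /interval_weight big_nat_recr //=; case: b => //; ring.
Qed.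

Lemma exec_add_spoke (R : realType) b (s : state R) :
  exec (add_spoke b) s =
  set_rreg s 3 (if b then rreg s 3 - rreg s 4 else rreg s 3 + rreg s 4).
Proof. by case: b. Qed.

Lemma rreg_base (R : realType) n (A : nat -> nat -> R) b i s :
  input_inv n A s -> rreg s (~~ b) = interval_weight n A b i i.
Proof. by move=> [_ [r0 r1]]; rewrite interval_weight_id; case: b. Qed.

(** Kadane's step. Passing vertex [j] changes the gains of all open intervals by the same spoke, so
    the best one stays best among them; its only new rival is the empty interval at [j+1]. *)
Lemma scan_body_correct (R : realType) n (A : nat -> nat -> R) b j m s :
  (0 < j < n)%N -> m b = j ->
  input_inv n A s -> best_inv n A m s -> scan_inv n A b j s ->
  wp (scan_body b) 19
     (fun s' => [/\ input_inv n A s',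
        best_inv n A (fun b' => if b' == b then j.+1 else m b') s'
        & scan_inv n A b j.+1 s']) s.
Proof.
move=> /andP[j0 jn] mb [[n0 z7 rA iA] [r0 r1]] [b0 [f5 cand w2 max2]].
move=> [j1 /andP[a0 aj] g3 max3].
have gS i : (i <= j)%N -> A 0%N i.-1 + interval_weight n A b i j.+1 =
    if b then A 0%N i.-1 + interval_weight n A b i j - A 1%N j
    else A 0%N i.-1 + interval_weight n A b i j + A 1%N j.
  by move=> ij; rewrite interval_weightS //; case: b {mb max3 g3}; rewrite addrA.
pose M := if b then rreg s 3 - A 1%N j else rreg s 3 + A 1%N j.
have MS i : (0 < i <= j)%N -> A 0%N i.-1 + interval_weight n A b i j.+1 <= M.
  move=> /andP[i0 ij]; rewrite gS // /M.
  by have := max3 i; rewrite i0 ij => /(_ isT); case: (b) => ?; lra.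
have Ma : M = A 0%N (ireg s 2).-1 + interval_weight n A b (ireg s 2) j.+1.
  by rewrite gS // /M g3.
apply: (@wp_seq _ _ _ 6 13); apply: wp_block.
apply: (@wp_seq _ _ _ 6 7).
(* Holds between the two conditionals: the best bond is updated, and the open interval is extended
   but not yet compared with a restart at [j+1]. *)
pose mid s' := [/\ input_inv n A s',
        best_inv n A (fun b' => if b' == b then j.+1 else m b') s'
        & [/\ ireg s' 1 = j.+1, ireg s' 2 = ireg s 2, rreg s' 3 = M &
              rreg s' 5 = A 0%N j]].
have cM i : (i <= j)%N -> candidate_weight n A b i j.+1 =
     A 0%N i.-1 + interval_weight n A b i j.+1 + A 0%N j.
  by move=> ij; rewrite /candidate_weight ltnS ij /=; ring.
have maxS (x : R) : rreg s 2 <= x -> M + A 0%N j <= x ->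
    forall b' lo hi, candidate n b' lo hi ->
    (hi <= if b' == b then j.+1 else m b')%N ->
    candidate_weight n A b' lo hi <= x.
  move=> le2 leM b' lo hi c hi_le.
  (* The only new candidates have flag [b] and right end [j+1]. *)
  case: (leqP hi (m b')) => [h|h]; first exact: le_trans (max2 _ _ _ c h) le2.
  move: hi_le; case: eqP => [eb|_]; last by lia.
  move: h; rewrite eb mb => h1 h2; have eh : hi = j.+1 by lia.
  move: c; rewrite eh eb /candidate => c.
  have {c}[lo0 loj] : (0 < lo /\ lo <= j)%N by lia.
  rewrite cM //; have := MS lo; rewrite lo0 loj => /(_ isT) ?; lra.
have midP : wp
    (If (RLt 2 6) (block [:: RMove 2 6; IMove 3 2; IMove 4 1; IConst 5 b]) Skip)
    6 mid
    (foldl (fun s' c => exec c s') s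
       [:: RLoad 4 1 1; add_spoke b; RLoad 5 0 1; RAdd 6 3 5; ISucc 1]).
  rewrite [foldl _ _ _]/= exec_add_spoke; apply: wp_if => hb.
    apply: wp_block; move: hb; rewrite /mid /input_inv /best_inv /= /upd /=.
    rewrite rA j1 -/M => hb; split; [by []| |by []].
    exists b; split=> //; first by rewrite /candidate; lia.
      by rewrite cM // Ma.
    by apply: maxS; [exact: ltW|exact: lexx].
  apply: (@wp_weaken _ _ 1 _ mid) => //; apply: wp_skip; move: hb.
  rewrite /mid /input_inv /best_inv /= /upd /= rA j1 -/M -leNgt => hb.
  split; [by []| |by []].
  by exists b0; split=> //; exact: maxS.
apply: wp_weaken midP => // s1 [inp1 best1 [j1' a1 M1 r5]].
apply: (@wp_seq _ _ _ 2 5); apply: wp_block.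
have base := rreg_base b j.+1 inp1.
have openS x : M <= x -> A 0%N j + interval_weight n A b j.+1 j.+1 <= x ->
    forall i, (0 < i <= j.+1)%N ->
    A 0%N i.-1 + interval_weight n A b i j.+1 <= x.
  move=> leM lej i /andP[i0]; rewrite leq_eqVlt ltnS => /orP[/eqP -> //|ij].
  by apply: le_trans leM; apply: MS; rewrite i0.
pose Q s' := [/\ input_inv n A s',
  best_inv n A (fun b' => if b' == b then j.+1 else m b') s'
  & scan_inv n A b j.+1 s'].
apply: wp_if => hb; move: inp1 => [[? ? ? ?] [? ?]].
  rewrite /= /upd /= r5 M1 base in hb.
  apply: (@wp_weaken _ _ 3 _ Q) => //; apply: wp_block.
  rewrite /Q /input_inv /best_inv /scan_inv /= /upd /= j1' r5 base.
  split=> //; split=> //; first by lia.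
  by apply: openS => //; exact: ltW.
rewrite /= /upd /= r5 M1 base -leNgt in hb.
apply: (@wp_weaken _ _ 1 _ Q) => //; apply: wp_skip.
rewrite /Q /input_inv /best_inv /scan_inv /= /upd /= j1' a1 M1.
split=> //; split=> //; first by lia.
exact: openS.
Qed.

Lemma sum_spokes_correct (R : realType) n (A : nat -> nat -> R) s :
  ireg s 0 = n -> ireg s 1 = 0%N -> ireg s 7 = 0%N -> rarr s = A ->
  (forall a k, iarr s a k = 0%N) -> rreg s 0 = 0 -> rreg s 1 = 0 ->
  wp sum_spokes (n * 5).+1 (input_inv n A) s.
Proof.
move=> n0 j0 z7 rA iA r0 r1.
pose Inv j (s' : state R) :=
  [/\ ireg s' 0 = n, ireg s' 7 = 0%N, rarr s' = A
    & forall a k, iarr s' a k = 0%N]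
  /\ [/\ ireg s' 1 = j, rreg s' 0 = \sum_(0 <= k < j) A 1%N k & rreg s' 1 = 0].
apply: (@wp_weaken _ _ (n * 5).+1 _ (Inv n)) => // [s' [? [_ ? ?]]|].
  by split.
apply: wp_while => [j s' jn [[n' z' A' i'] [j' r' r1']]
  |s' [[n' _ _ _] [j' _ _]]|].
- split; first by rewrite /= j' n'.
  apply: wp_block; rewrite /Inv /= /upd /= A' j'; split=> //.
  by split=> //; rewrite big_nat_recr //= r'.
- by rewrite /= n' j' ltnn.
- by split=> //; rewrite big_geq.
Qed.

Lemma scan_correct (R : realType) n (A : nat -> nat -> R) b m s :
  (0 < n)%N -> m b = 1%N -> input_inv n A s -> best_inv n A m s ->
  wp (scan b) (n * 20 + 6)
     (fun s' => input_inv n A s' /\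
        best_inv n A (fun b' => if b' == b then n else m b') s') s.
Proof.
move=> n0 mb inp best; set Q := (Q in wp _ _ Q _).
(* The position runs from 1 to [n]; each of the [n-1] iterations costs at most 19 steps and a
   test. *)
apply: (@wp_weaken _ _ (5 + (n.-1 * 20).+1) _ Q) => //; first by lia.
apply: wp_seq; apply: wp_block.
pose Inv i s' := [/\ input_inv n A s',
  best_inv n A (fun b' => if b' == b then i.+1 else m b') s'
  & scan_inv n A b i.+1 s'].
apply: (@wp_weaken _ _ (n.-1 * 20).+1 _ (Inv n.-1)) => //.
  by move=> s' [? + _]; rewrite /Q prednK.
apply: wp_while => [i s' lt_in [inp' best' scan']
  |s' [[[n' _ _ _] _] _ [j' _ _ _]]|].
- split.
    by have [[? _ _ _] _] := inp'; have [? _ _ _] := scan'; rewrite /=; lia.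
  have i_in : (0 < i.+1 < n)%N by lia.
  have eqb : (if b == b then i.+1 else m b) = i.+1 by rewrite eqxx.
  apply: wp_weaken (scan_body_correct i_in eqb inp' best' scan') => //.
  move=> s1 [inp1 best1 scan1]; split=> //.
  have [b1 [? ? ? best1']] := best1; exists b1; split=> // b' lo hi c.
  by case: eqP => [e|ne] h; apply: best1' => //; case: eqP.
- by rewrite /= n' j'; lia.
have [[n' z' A' i'] [r0 r1]] := inp; have [b0 [f5 cand r2 max2]] := best.
rewrite /Inv /input_inv /best_inv /scan_inv /= /upd /= A' z'; split=> //.
  exists b0; split=> // b' lo hi c; case: eqP => [eb|_]; last exact: max2.
  by move=> h; apply: max2 c _; rewrite eb mb.
(* The base value is in register 0 or 1, hence untouched by the load into register 3. *)
have -> : ((~~ b : nat) == 3%N) = false by case: (b).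
rewrite (rreg_base b 1 inp); split=> // i hi.
by have -> : i = 1%N by [lia].
Qed.

Lemma write_output_correct (R : realType) n (A : nat -> nat -> R) m s :
  input_inv n A s -> best_inv n A m s ->
  wp write_output (n * 4 + 4)
    (fun s' => exists b lo hi, [/\ candidate n b lo hi,
       iarr s' 0 n = b, forall k, (k < n)%N -> iarr s' 0 k = (lo <= k < hi)%N &
       forall b' lo' hi', candidate n b' lo' hi' -> (hi' <= m b')%N ->
         candidate_weight n A b' lo' hi' <= candidate_weight n A b lo hi]) s.
Proof.
move=> [[n0 z7 rA iA] _] [b [f5 cand r2 max2]].
set lo := ireg s 3 in cand r2; set hi := ireg s 4 in cand r2.
have [lo0 [lohi hin]] : (0 < lo /\ lo <= hi /\ hi <= n)%N.
  by move: cand; rewrite /candidate; lia.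
pose Inv i (s' : state R) :=
  [/\ ireg s' 1 = 1%N, ireg s' 3 = (lo + i)%N, ireg s' 4 = hi,
      iarr s' 0 n = b & forall k, (k < n)%N -> iarr s' 0 k = (lo <= k < lo + i)%N].
apply: (@wp_weaken _ _ (3 + ((hi - lo) * 4).+1) _ (Inv (hi - lo)%N))
  => [|s' [_ _ _ nb kb]|].
- by lia.
- exists b, lo, hi; split=> //; last by rewrite -r2.
  by move=> k kn; rewrite kb //; congr nat_of_bool; lia.
apply: wp_seq; apply: wp_block.
apply: wp_while => [i s' lt_i [i1 i3 i4 nb kb]|s' [_ i3 i4 _ _]|].
- split; first by rewrite /= i3 i4; lia.
  apply: wp_block; rewrite /Inv /= /upd2 /upd /= i3 i1; split=> //.
  + by rewrite addnS.
  (* The hub entry at [n] is not overwritten, since [lo + i < hi <= n]. *)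
  + by case: eqP => // ?; lia.
  + move=> k kn; case: eqP => [->|ne]; first by lia.
    by rewrite kb //; congr nat_of_bool; lia.
- by rewrite /= i3 i4; lia.
rewrite /Inv /= /upd2 /upd /= n0 eqxx f5; split=> //; first by rewrite addn0.
by move=> k kn; case: eqP => [?|_]; [lia|rewrite iA addn0; lia].
Qed.

Lemma wheel_max_bond_correct (R : realType) n (A : nat -> nat -> R) s :
  (0 < n)%N ->
  ireg s 0 = n -> ireg s 1 = 0%N -> ireg s 7 = 0%N -> rarr s = A ->
  (forall a k, iarr s a k = 0%N) -> rreg s 0 = 0 -> rreg s 1 = 0 ->
  wp wheel_max_bond (n * 100)
    (fun s' => exists b lo hi, [/\ candidate n b lo hi,
       iarr s' 0 n = b, forall k, (k < n)%N -> iarr s' 0 k = (lo <= k < hi)%N &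
       forall b' lo' hi', candidate n b' lo' hi' ->
         candidate_weight n A b' lo' hi' <= candidate_weight n A b lo hi]) s.
Proof.
move=> n0 i0 i1 i7 rA iA r0 r1.
set Q := (Q in wp _ _ Q _).
pose scan_time := (n * 20 + 6)%N.
(* The phases add up to [49 n + 22], which is at most [100 n] as [n] is positive. *)
apply: (@wp_weaken _ _ ((n * 5).+1 +
  (5 + (scan_time + (scan_time + (n * 4 + 4))))) _ Q) => //.
  by lia.
apply: wp_seq.
apply: wp_weaken (sum_spokes_correct i0 i1 i7 rA iA r0 r1) => // s1 inp1.
apply: wp_seq; apply: wp_block.
set s2 := foldl _ _ _.
have [inp2 best2] : input_inv n A s2 /\ best_inv n A (fun=> 1%N) s2.
  have [[n1 z1 A1 ia1] [t1 u1]] := inp1.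
  rewrite /s2 /input_inv /best_inv /= /upd /=; split=> //.
  have c1 : candidate_weight n A true 1 1 = rreg s1 0.
    by rewrite /candidate_weight interval_weight_id ltnn addr0.
  exists true; split=> //; first by rewrite /candidate n0.
  move=> b lo hi; rewrite /candidate => c h.
  (* A candidate with right end at most 1 has an empty interval, so it is the hub alone. *)
  have [-> -> ->] : [/\ b, lo = 1%N & hi = 1%N] by split; lia.
  by rewrite c1.
apply: wp_seq.
apply: wp_weaken (scan_correct n0 _ inp2 best2) => // s3 [inp3 best3].
apply: wp_seq.
apply: wp_weaken (scan_correct n0 _ inp3 best3) => // s4 [inp4 best4].
apply: wp_weaken (write_output_correct inp4 best4) => // s5.
move=> [b [lo [hi [c nb kb mx]]]].
exists b, lo, hi; split=> // b' lo' hi' c'; apply: mx => //.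
(* After both scans the bound is [n] for either flag, which covers every candidate. *)
by move: c'; rewrite /candidate; case: (b') => /=; lia.
Qed.

(* Optimality among all bonds, in linear time *)
Local Close Scope ring_scope.

Theorem theorem7 (R : realType) :
  exists (p : program) (C : nat),
    forall (n : nat) (w : {set option 'I_n} -> R), 3 <= n ->
      exists (t : nat) (s : state R) (S : {set option 'I_n}),
        [/\ run p (wheel_input w) t s,
            t <= C * n,
            wheel_output s S
          & is_max_bond (wheel n) w S].
Proof.
exists wheel_max_bond, 100%N => n w n2.
have n0 : (0 < n)%N by lia.
have [t [s [rp le_t [b [lo [hi [c hub rim max]]]]]]] :=
  wheel_max_bond_correct (s := wheel_input w) n0 erefl erefl erefl erefl
    (fun _ _ => erefl) erefl erefl.
exists t, s, (arc_set n b lo hi); split=> //; first by rewrite mulnC.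
  by move=> [i|]; rewrite inE; [exact: rim (ltn_ord i)|exact: hub].
split; first exact: arc_set_bond.
have max_avoid (S' : {set option 'I_n}) : is_bond (wheel n) S' ->
    Some (Ordinal n0) \notin S' ->
    (cut_weight (wheel n) w S' <= cut_weight (wheel n) w (arc_set n b lo hi))%R.
  move=> bS' zS'.
  have [b' [lo' [hi' [c' ->]]]] := bond_arc_set (z := Ordinal n0) bS' erefl zS'.
  by rewrite !wheel_arc_weight // max.
(* A bond containing vertex 0 is replaced by its complement, a bond with the same cut edges. *)
move=> S' bS'; case: (boolP (Some (Ordinal n0) \in S')) => zS'.
  rewrite {1}/cut_weight -cut_edgesC.
    by apply: max_avoid; rewrite ?bondC // inE zS'.
  by case=> [i|] //; rewrite wheel_rimE; have := ltn_ord i; lia.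
exact: max_avoid.
Qed.
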